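(* Assume $u_1\in\mathbb{R}$ and $A_1,A_2,\sigma_1,\sigma_2>0$ are all fixed, and let $$\overline u=\frac{A_1u_1+A_2u_2}{A_1+A_2},\qquad \overline c=\sqrt{\frac{g(A_1+A_2)}{\sigma_2}}.$$ Let $\delta=(u_2-u_1)/\overline c$ and $\epsilon=1-r$, and assume that both parameters $\delta$ and $\epsilon$ go to zero at the same rate. Then the external eigenvalues of the matrix $M$ satisfy $$\lambda_{ext}^{\pm}=\overline u\pm\overline c\mp\frac{\epsilon}{2}\,\frac{\frac{gA_1}{\sigma_2}}{\sqrt{\frac{g(A_1+A_2)}{\sigma_2}}}\left(1-\frac{\frac{gA_1}{\sigma_1}}{\frac{g(A_1+A_2)}{\sigma_2}}\right)+\overline c\;O(\delta^2)\qquad\text{as }\delta\to0 .$$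
   Context: Here $g>0$ is a fixed constant and $r=1-\epsilon\le1$ is the density ratio. The parameters $u_2$ and $r$ vary while $u_1,A_1,A_2,\sigma_1,\sigma_2$ are fixed. ''At the same rate'' means $\epsilon=O(|\delta|)$ and $|\delta|=O(\epsilon)$. The matrix is $$M=\begin{pmatrix} 0&1&0&0\\ c_1^2-u_1^2&2u_1&rg\frac{A_1}{\sigma_2}&0\\ 0&0&0&1\\ c_2^2&0&c_2^2-u_2^2&2u_2\end{pmatrix},\qquad c_2^2=\frac{gA_2}{\sigma_2},\qquad c_1^2=g\left(r\frac{A_1}{\sigma_2}+\epsilon\frac{A_1}{\sigma_1}\right),$$ with characteristic polynomial $$p(\lambda)=\left[(\lambda-u_1)^2-c_1^2\right]\left[(\lambda-u_2)^2-c_2^2\right]-r\frac{gA_1}{\sigma_2}c_2^2 .$$ It is the coefficient matrix of the quasilinear form of the two-layer shallow-water equations in a channel (layer velocities $u_1,u_2$, wet areas $A_1,A_2$, widths $\sigma_1,\sigma_2$ at the top of the internal and external layers). The external eigenvalues $\lambda_{ext}^{\pm}$ are the two roots of $p$ that tend to $u_1+\overline c$ and $u_1-\overline c$, respectively, as $\delta,\epsilon\to0$ (the other two roots, the internal eigenvalues, tend to $u_1$). *)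

(* Defs.v *)
From HB Require Import structures.
From mathcomp Require Import all_boot all_order all_algebra.
From mathcomp Require Import complex.
From mathcomp Require Import mathcomp_extra boolp classical_sets functions.
From mathcomp Require Import reals topology normedtype landau.

Set Implicit Arguments.
Unset Strict Implicit.
Unset Printing Implicit Defensive.

Import Order.TTheory GRing.Theory Num.Theory.
Import numFieldNormedType.Exports.

Local Open Scope classical_set_scope.
Local Open Scope ring_scope.
Local Open Scope complex_scope.

(** Two-layer shallow-water equations in a channel: layer [j] has velocity
    [uj] and wet area [Aj]; [s1] and [s2] are the channel widths at the top of
    the internal and external layers, and [r = 1 - eps] is the density ratio. *)

Definition c1_sq (R : realType) (g A1 s1 s2 r : R) : R :=
  g * (r * (A1 / s2) + (1 - r) * (A1 / s1)).

Definition c2_sq (R : realType) (g A2 s2 : R) : R := g * A2 / s2.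

Definition two_layer_mx (R : realType) (g u1 u2 A1 A2 s1 s2 r : R) : 'M[R]_4 :=
  let c1 := c1_sq g A1 s1 s2 r in
  let c2 := c2_sq g A2 s2 in
  let rows :=
    [:: [:: 0;             1;       0;                  0];
        [:: c1 - u1 ^+ 2;  2 * u1;  r * g * (A1 / s2);  0];
        [:: 0;             0;       0;                  1];
        [:: c2;            0;       c2 - u2 ^+ 2;       2 * u2]] in
  \matrix_(i < 4, j < 4) nth 0 (nth [::] rows i) j.

(** [R[i]^o] is [R[i]] with its canonical topology and norm.  The eigenvalues
    are complex a priori (the internal ones need not be real). *)
Definition eigenvalue_tending_to (R : realType) (T : Type) (F : set_system T)
    (M : T -> 'M[R]_4) (l : R) (lam : T -> R[i]^o) : Prop :=
  (\forall t \near F, eigenvalue (map_mx (real_complex R) (M t)) (lam t)) /\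
  lam @ F --> (l%:C : R[i]^o).

Definition ubar (R : realType) (u1 u2 A1 A2 : R) : R :=
  (A1 * u1 + A2 * u2) / (A1 + A2).

Definition cbar (R : realType) (g A1 A2 s2 : R) : R :=
  Num.sqrt (g * (A1 + A2) / s2).

(* Main.v *)
(** Put x = lambda - u1, d = u2 - u1, a = g A1 / s2, b = g A2 / s2 and
    m = a - g A1 / s1.  The characteristic equation becomes
      (x^2 - a + eps m) ((x - d)^2 - b) = (1 - eps) a b,
    and at d = eps = 0 it reads x^2 (x^2 - (a + b)) = 0, so that x = s is a
    simple root for s = cbar and for s = - cbar.  Expanding at x = s + w,
      2 s^3 (w - L) = - (a w^2 + b (w - d)^2 + A B),
      L = (b / s^2) d - eps a (m + b) / (2 s^3),
    with A = 2 s w + w^2 + eps m and B = 2 s (w - d) + (w - d)^2.  The right-hand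
    side is quadratic in (w, d, eps) and w tends to 0, whence w = O(d), and then
    w - L = O(d^2).  Existence: the product of the distances from u1 + s to the
    four roots is |p(u1 + s)|, which tends to 0, so the nearest root converges to
    u1 + s. *)
Require Import Defs.
From HB Require Import structures.
From mathcomp Require Import all_boot all_order all_algebra.
From mathcomp Require Import complex.
From mathcomp Require Import mathcomp_extra boolp classical_sets functions.
From mathcomp Require Import reals topology normedtype landau.
From mathcomp Require Import ring lra.

Set Implicit Arguments.
Unset Strict Implicit.
Unset Printing Implicit Defensive.

Import Order.TTheory GRing.Theory Num.Theory.
Import numFieldNormedType.Exports.

Local Open Scope classical_set_scope.
Local Open Scope ring_scope.
Local Open Scope complex_scope.

Import Normc.

(** * Characteristic equation of the matrix *)

Lemma mul_two_layer_mx (R : realType) (g u1 u2 A1 A2 s1 s2 r : R) (v : 'I_4 -> R[i])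
    (c1 := c1_sq g A1 s1 s2 r) (c2 := c2_sq g A2 s2)
    (x := v 0) (y := v 1) (z := v 2%:R) (w := v 3%:R) :
  (\row_i v i) *m map_mx (real_complex R) (two_layer_mx g u1 u2 A1 A2 s1 s2 r) =
  \row_i [:: y * (c1 - u1 ^+ 2)%:C + w * c2%:C;
             x + y * (2 * u1)%:C;
             y * (r * g * (A1 / s2))%:C + w * (c2 - u2 ^+ 2)%:C;
             z + w * (2 * u2)%:C]`_i.
Proof.
have E0 : 0%:C = 0 :> R[i] by [].
have E1 : 1%:C = 1 :> R[i] by [].
have [e1 e2 e3] : [/\ lift ord0 ord0 = 1 :> 'I_4,
    lift ord0 (lift ord0 ord0) = 2%:R :> 'I_4 &
    lift ord0 (lift ord0 (lift ord0 ord0)) = 3%:R :> 'I_4].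
  by split; apply/val_inj.
by apply/rowP; case; do 4?[case]; move=> //= k;
  rewrite !mxE !big_ord_recl big_ord0 !mxE /=;
  rewrite ?e1 ?e2 ?e3 E0 ?E1 ?mulr0 ?mulr1 ?add0r ?addr0.
Qed.

(** Elimination in a row eigenvector replaces the expansion of a determinant. The second and fourth
    columns express coordinates 0 and 2 through coordinates 1 and 3; the other two columns then give
    the relations [P1] and [P2], whose product is the equation. *)
Lemma eigenvalue_two_layer (R : realType) (g u1 u2 A1 A2 s1 s2 r : R) (z : R[i]) :
  c2_sq g A2 s2 != 0 ->
  eigenvalue (map_mx (real_complex R) (two_layer_mx g u1 u2 A1 A2 s1 s2 r)) z <->
  ((z - u1%:C) ^+ 2 - (c1_sq g A1 s1 s2 r)%:C) *
  ((z - u2%:C) ^+ 2 - (c2_sq g A2 s2)%:C) =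
  (r * g * (A1 / s2) * c2_sq g A2 s2)%:C.
Proof.
set c1 := c1_sq _ _ _ _ _; set c2 := c2_sq _ _ _ => c20.
set k := r * g * _.
split=> [/eigenvalueP[v]|eq0].
  rewrite (_ : v = \row_i v 0 i); last by apply/rowP => i; rewrite mxE.
  rewrite mul_two_layer_mx -/c1 -/c2 -/k /=.
  set a := v 0 0; set b := v 0 1; set c := v 0 2%:R; set d := v 0 3%:R.
  move=> /rowP E v0.
  have E0 : b * (c1 - u1 ^+ 2)%:C + d * c2%:C = z * a.
    by have := E 0; rewrite !mxE; apply.
  have E1 : a + b * (2 * u1)%:C = z * b by have := E 1; rewrite !mxE; apply.
  have E2 : b * k%:C + d * (c2 - u2 ^+ 2)%:C = z * c.
    by have := E 2%:R; rewrite !mxE; apply.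
  have E3 : c + d * (2 * u2)%:C = z * d by have := E 3%:R; rewrite !mxE; apply.
  have ea : a = z * b - b * (2 * u1)%:C by rewrite -E1 addrK.
  have ec : c = z * d - d * (2 * u2)%:C by rewrite -E3 addrK.
  have P1 : ((z - u1%:C) ^+ 2 - c1%:C) * b = c2%:C * d.
    by apply: (addrI (b * (c1 - u1 ^+ 2)%:C)); rewrite [c2%:C * d]mulrC E0 ea; ring.
  have P2 : ((z - u2%:C) ^+ 2 - c2%:C) * d = k%:C * b.
    by apply: (addIr (d * (c2 - u2 ^+ 2)%:C)); rewrite [k%:C * b]mulrC E2 ec; ring.
  (* If [b = 0], then [P1] and [c2 != 0] force [d = 0], and the whole eigenvector vanishes. *)
  have [b0|b0] := eqVneq b 0.
    have c2C0 : c2%:C != 0 by apply: contra c20 => /eqP/complexI/eqP.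
    have d0 : d = 0.
      by apply/eqP; move: P1; rewrite b0 mulr0 => /esym/eqP;
        rewrite mulf_eq0 (negPf c2C0).
    have a0 : a = 0 by rewrite ea b0; ring.
    have c0 : c = 0 by rewrite ec d0; ring.
    case/eqP: v0; apply/rowP; case; do 4?[case]; move=> //= ?; rewrite !mxE;
      [rewrite -a0|rewrite -b0|rewrite -c0|rewrite -d0]; congr (v 0 _); exact/val_inj.
  apply: (mulIf b0); rewrite mulrAC P1 -mulrA [d * _]mulrC P2 (rmorphM _ k c2) /=; ring.
apply/eigenvalueP.
(* The choice [b = c2], [d = p] solves [P1] identically; the equation itself is needed only for
   coordinate 2. *)
pose p := (z - u1%:C) ^+ 2 - c1%:C.
pose v := [:: (z - (2 * u1)%:C) * c2%:C; c2%:C; (z - (2 * u2)%:C) * p; p].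
exists (\row_(i < 4) v`_i); last first.
  apply/eqP => /rowP /(_ 1); rewrite !mxE /= => /complexI c20'.
  by rewrite c20' eqxx in c20.
rewrite mul_two_layer_mx -/c1 -/c2 -/k /=.
apply/rowP; case; do 4?[case]; move=> //= ?; rewrite !mxE /= /p; [ring|ring| |ring].
rewrite [_ * k%:C](_ : _ =
  ((z - u1%:C) ^+ 2 - c1%:C) * ((z - u2%:C) ^+ 2 - c2%:C)).
  ring.
by rewrite eq0 (rmorphM _ k c2) /= mulrC.
Qed.

(** * A root of a monic polynomial near a given point *)

Lemma exists_min_norm (K : numDomainType) (V : semiNormedZmodType K) (x : V) s :
  exists2 z, z \in x :: s & forall y, y \in x :: s -> `|z| <= `|y|.
Proof.
elim: s x => [|y s IH] x.
  by exists x; rewrite ?mem_head // => y; rewrite inE => /eqP ->.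
have [z zs zmin] := IH y.
have [zx|xz] := real_leP (normr_real z) (normr_real x).
  exists z; first by rewrite inE zs orbT.
  by move=> w; rewrite inE => /predU1P[->|/zmin].
exists x; first exact: mem_head.
by move=> w; rewrite inE => /predU1P[->//|/zmin]; apply: le_trans; apply: ltW.
Qed.

(** Since [p] splits, [|p.[x]|] is the product of the [(size p).-1] distances from [x] to the roots,
    each at least the smallest one. *)
Lemma ex_root_near (K : numClosedFieldType) (p : {poly K}) (x : K) :
  p \is monic -> (1 < size p)%N ->
  exists2 z, root p z & `|x - z| ^+ (size p).-1 <= `|p.[x]|.
Proof.
move=> pm; have [s Ep] := closed_field_poly_normal p.
have {}Ep : p = \prod_(z <- s) ('X - z%:P) by rewrite {1}Ep (monicP pm) scale1r.
rewrite {}Ep {p pm} size_prod_XsubC ltnS /=; case: s => // z0 s _.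
have [y ys ymin] := exists_min_norm (x - z0) [seq x - z | z <- s].
have /mapP[z zs yE] : y \in [seq x - z | z <- z0 :: s] by [].
exists z; first by rewrite root_prod_XsubC.
rewrite -yE horner_prod normr_prod -[size _]/(size (z0 :: s)).
rewrite -(count_predT (z0 :: s)) -iter_mulr_1 -big_const_seq !big_seq.
apply: ler_prod => w ws; rewrite normr_ge0 hornerXsubC ymin //.
exact: (map_f (fun z => x - z) ws).
Qed.

(** * Quantitative perturbation of a simple root *)

Lemma normc_real (R : rcfType) (x : R) : normc x%:C = `|x|.
Proof. by rewrite /normc /= expr0n addr0 sqrtr_sqr. Qed.

Lemma normc_ge0 (R : rcfType) (z : R[i]) : 0 <= normc z.
Proof. by case: z => x y; apply: sqrtr_ge0. Qed.

Lemma normcD_le (R : rcfType) (x y : R[i]) (p q : R) :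
  normc x <= p -> normc y <= q -> normc (x + y) <= p + q.
Proof. by move=> xp yq; apply: le_trans (le_normcD _ _) (lerD xp yq). Qed.

Lemma normcM_le (R : rcfType) (x y : R[i]) (p q : R) :
  normc x <= p -> normc y <= q -> normc (x * y) <= p * q.
Proof. by move=> xp yq; rewrite normcM ler_pM // normc_ge0. Qed.

(** [W], [D], [E] stand for the moduli of w, d, eps in the remainder. Because [S <= 1], squares are
    absorbed into [S], and each factor of the last product is at most [(2 * s + 1 + m) * S]. *)
Lemma quadratic_remainder_bound (R : realFieldType) (a b m s W D E : R)
    (S := W + D + E) :
  0 <= a -> 0 <= b -> 0 <= m -> 0 <= s -> 0 <= W -> 0 <= D -> 0 <= E -> S <= 1 ->
  a * W ^+ 2 + b * (W + D) ^+ 2 +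
    (2 * s * W + W ^+ 2 + E * m) * (2 * s * (W + D) + (W + D) ^+ 2) <=
  (a + b + (2 * s + 1 + m) ^+ 2) * S ^+ 2.
Proof.
move=> a0 b0 m0 s0 W0 D0 E0 S1.
have WS : W <= S by rewrite /S; lra.
have WDS : W + D <= S by rewrite /S; lra.
have ES : E <= S by rewrite /S; lra.
have S0 : 0 <= S by rewrite /S; lra.
clearbody S.
have sq x : 0 <= x -> x <= S -> x ^+ 2 <= S.
  by move=> x0 xS; rewrite expr2 (le_trans _ xS) // ler_piMr // (le_trans xS).
have WD0 : 0 <= W + D by lra.
have A1 : 2 * s * W + W ^+ 2 + E * m <= (2 * s + 1 + m) * S.
  have := sq W W0 WS; have := ler_wpM2l s0 WS; have := ler_wpM2l m0 ES; lra.
have B1 : 2 * s * (W + D) + (W + D) ^+ 2 <= (2 * s + 1 + m) * S.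
  have := sq _ WD0 WDS; have := ler_wpM2l s0 WDS; have := mulr_ge0 m0 S0; lra.
set k := 2 * s + 1 + m in A1 B1 *.
rewrite (_ : (a + b + k ^+ 2) * S ^+ 2 =
  a * S ^+ 2 + b * S ^+ 2 + k * S * (k * S)); last ring.
rewrite !lerD //.
- by rewrite ler_wpM2l // lerXn2r ?nnegrE.
- by rewrite ler_wpM2l // lerXn2r ?nnegrE.
- by rewrite ler_pM // !addr_ge0 ?mulr_ge0 ?sqr_ge0.
Qed.

(* [C * S ^+ 2 <= S / 2] is absorbed in [S <= n + (c + 1 + k) * D], so that
   [S] is at most [2 * (c + 1 + k) * D]. *)
Lemma quadratic_bootstrap (R : realFieldType) (C c k n W D E : R) (S := W + D + E) :
  0 <= C -> 0 <= D -> E <= k * D -> C * S <= 2^-1 -> 0 <= S ->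
  n <= C * S ^+ 2 -> W <= n + c * D ->
  n <= 4 * C * (c + 1 + k) ^+ 2 * D ^+ 2.
Proof.
move=> C0 D0 Ek CS S0 nS Wn.
have nS2 : n <= S / 2.
  by apply: le_trans nS _; rewrite expr2 mulrA [S / 2]mulrC ler_wpM2r.
have SD : S <= 2 * (c + 1 + k) * D by rewrite {1}/S; move: nS2; rewrite /S; nra.
apply: le_trans nS _.
rewrite (_ : _ * _ * _ * _ = C * (2 * (c + 1 + k) * D) ^+ 2); last ring.
by rewrite ler_wpM2l // lerXn2r ?nnegrE // (le_trans S0).
Qed.

(** [eta] and [K] are chosen before [w], [d], [e], so the estimate applies along any filter. The
    sign of [s] is free, which covers both external roots. *)
Lemma root_perturbation (R : rcfType) (a b m s k : R) : 0 <= k ->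
  s != 0 -> s ^+ 2 = a + b ->
  exists eta K : R, [/\ 0 < eta, 0 <= K & forall (w : R[i]) (d e : R),
    normc w <= eta -> `|d| <= eta -> `|e| <= k * `|d| ->
    ((s%:C + w) ^+ 2 - (a - e * m)%:C) * ((s%:C + w - d%:C) ^+ 2 - b%:C) =
      ((1 - e) * a * b)%:C ->
    normc (w - (b / s ^+ 2 * d - e * (a * (m + b) / (2 * s ^+ 3)))%:C) <= K * d ^+ 2].
Proof.
move=> k0 s0 sab.
(* [N] comes from [quadratic_remainder_bound], [C] from dividing it by [2 * |s| ^+ 3], and [c]
   satisfies [|L| <= c * |d|] as soon as [|e| <= k * |d|]. *)
pose N := `|a| + `|b| + (2 * `|s| + 1 + `|m|) ^+ 2.
pose C := N / (2 * `|s| ^+ 3).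
pose c := `|b / s ^+ 2| + k * `|a * (m + b) / (2 * s ^+ 3)|.
have s3 : 0 < 2 * `|s| ^+ 3 by rewrite mulr_gt0 // exprn_gt0 // normr_gt0.
have N0 : 0 <= N by rewrite !addr_ge0 // sqr_ge0.
have C0 : 0 <= C by rewrite divr_ge0 // ltW.
have C1 : 0 < 1 + 2 * C by lra.
have k2 : 0 < 2 + k by lra.
(* The sum [S] of the three moduli is at most [(2 + k) * eta], so this [eta] gives
   [S * (1 + 2 * C) <= 1], hence both [S <= 1] and [C * S <= 1 / 2]. *)
exists (((2 + k) * (1 + 2 * C))^-1), (4 * C * (c + 1 + k) ^+ 2).
split; first by rewrite invr_gt0 mulr_gt0.
  by apply: mulr_ge0; [lra|exact: sqr_ge0].
move=> w d e; set eta := _^-1 => weta deta ek eq0.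
set L := b / _ * d - _; set n := normc _.
pose S := normc w + `|d| + `|e|.
have S0 : 0 <= S by rewrite !addr_ge0 // normc_ge0.
have Seta : S * (1 + 2 * C) <= 1.
  have etaE : (2 + k) * eta * (1 + 2 * C) = 1.
    by rewrite mulrAC mulfV // mulf_neq0 // gt_eqF.
  have kdeta : k * `|d| <= k * eta by rewrite ler_wpM2l.
  by rewrite -[X in _ <= X]etaE ler_pM2r // /S; lra.
have S1 : S <= 1 by nra.
have n_le : n <= C * S ^+ 2.
  rewrite /C mulrAC ler_pdivlMr //.
  have -> : n * (2 * `|s| ^+ 3) = normc (a%:C * w ^+ 2 + b%:C * (w - d%:C) ^+ 2 +
    ((2 * s)%:C * w + w ^+ 2 + e%:C * m%:C) *
      ((2 * s)%:C * (w - d%:C) + (w - d%:C) ^+ 2)).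
    rewrite -(normcN (_ + _)) -[2 in LHS]gtr0_norm //.
    rewrite -normrX -normrM -normc_real -normcM.
    congr normc.
    have L_E : 2 * s ^+ 3 * L = 2 * s * b * d - e * a * (m + b) by rewrite /L; field.
    rewrite mulrBl -rmorphM [L * _]mulrC L_E.
    (* With this substitution the factors of the equation are [b + A] and [a + B], where A and B are
       the increments at [s + w]; the terms of first order in their expansion sum to
       [2 * s ^+ 3 * (w - L)]. *)
    have aE : a = s ^+ 2 - b by rewrite sab addrK.
    apply/eqP; rewrite -subr_eq0; move/eqP: eq0; rewrite -subr_eq0 aE => /eqP eq0.
    rewrite -[X in _ == X]eq0; apply/eqP => /=; ring.
  apply: le_trans (quadratic_remainder_bound _ _ _ _ _ _ _ S1) => //;
    last exact: normc_ge0.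
  have normcR x : normc x%:C <= `|x| by rewrite normc_real.
  have wd : normc (w - d%:C) <= normc w + `|d| by rewrite normcD_le // normcN normcR.
  have s2 : normc (2 * s)%:C <= 2 * `|s| by rewrite normc_real normrM gtr0_norm.
  by rewrite !expr2; do ![done | apply: normcD_le | apply: normcM_le].
have w_le : normc w <= n + c * `|d|.
  rewrite -{1}[w](subrK L%:C) normcD_le // normc_real.
  rewrite /L (le_trans (ler_normB _ _)) // (normrM _ d) (normrM e) /c.
  by rewrite (mulrDl _ _ `|d|) lerD2l (mulrAC k) ler_wpM2r.
rewrite -[d ^+ 2]real_normK ?num_real //.
by apply: (quadratic_bootstrap C0 (normr_ge0 d) ek _ S0 n_le w_le); rewrite -/S; lra.
Qed.

(** * Existence of the external eigenvalues *)

Lemma monic_subC (K : nzRingType) (p : {poly K}) (c : K) :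
  p \is monic -> (1 < size p)%N ->
  p - c%:P \is monic /\ size (p - c%:P) = size p.
Proof.
move=> pm p1; have lt : (size (- c%:P : {poly K}) < size p)%N.
  by rewrite size_polyN (leq_ltn_trans (size_polyC_leq1 c)).
by rewrite monicE lead_coefDl // -monicE pm size_polyDl.
Qed.

(** The norm on [R[i]] takes values in [R[i]], where positive elements are real; the radii can
    therefore be taken in [R]. *)
Lemma cvg_complexP (R : realType) (T : Type) (F : filter_on T)
    (f : T -> R[i]^o) (l : R) :
  f @ F --> (l%:C : R[i]^o) <->
  forall e, 0 < e -> \forall t \near F, normc (f t - l%:C) < e.
Proof.
split=> [/cvgrPdist_lt fl e e0|fl].
  have /fl : 0 < e%:C :> R[i] by rewrite ltcR.
  apply: filterS => t; rewrite distrC.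
  by rewrite -ltcR.
apply/cvgrPdist_lt => e e0.
have /complex_realP[k ek] : e \is Num.real by rewrite gtr0_real.
move: e0; rewrite {}ek ltcR => /fl.
by apply: filterS => t; rewrite distrC -ltcR.
Qed.

Lemma ex_eigenvalue_tending_to (R : realType) (g u1 A1 A2 s1 s2 s : R)
    (T : Type) (F : filter_on T) (u2 r : T -> R) :
  0 < g -> 0 < A2 -> 0 < s2 -> s ^+ 2 = g * (A1 + A2) / s2 ->
  u2 @ F --> u1 -> r @ F --> (1 : R) ->
  exists lam, eigenvalue_tending_to F
    (fun t => two_layer_mx g u1 (u2 t) A1 A2 s1 s2 (r t)) (u1 + s) lam.
Proof.
move=> g0 A20 s20 sE u2F rF.
have c20 : c2_sq g A2 s2 != 0 by rewrite gt_eqF // !(mulr_gt0, invr_gt0).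
pose q t (x : R) := ((x - u1) ^+ 2 - c1_sq g A1 s1 s2 (r t)) *
  ((x - u2 t) ^+ 2 - c2_sq g A2 s2) - r t * g * (A1 / s2) * c2_sq g A2 s2.
have near_root t : exists z : R[i],
    eigenvalue (map_mx (real_complex R)
      (two_layer_mx g u1 (u2 t) A1 A2 s1 s2 (r t))) z /\
    normc (z - (u1 + s)%:C) ^+ 4 <= `|q t (u1 + s)|.
  pose p1 (x y : R) : {poly R[i]} := ('X - x%:C%:P) ^+ 2 - y%:C%:P.
  have p1E x y : p1 x y \is monic /\ size (p1 x y) = 3.
    by have [] := @monic_subC _ (('X - x%:C%:P) ^+ 2) y%:C;
      rewrite ?monic_exp ?monicXsubC ?size_exp_XsubC.
  pose k := r t * g * (A1 / s2) * c2_sq g A2 s2.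
  pose p0 := p1 u1 (c1_sq g A1 s1 s2 (r t)) * p1 (u2 t) (c2_sq g A2 s2).
  have [m1 z1] := p1E u1 (c1_sq g A1 s1 s2 (r t)).
  have [m2 z2] := p1E (u2 t) (c2_sq g A2 s2).
  have m0 : p0 \is monic by rewrite rpredM.
  have z0 : size p0 = 5 by rewrite size_monicM ?z1 ?z2 // monic_neq0.
  have [] := @monic_subC _ p0 k%:C m0; rewrite z0 // => pm zp.
  have [z rz] := ex_root_near (u1 + s)%:C pm (ltac:(by rewrite zp)).
  have pE x : (p0 - k%:C%:P).[x] = ((x - u1%:C) ^+ 2 - (c1_sq g A1 s1 s2 (r t))%:C) *
     ((x - (u2 t)%:C) ^+ 2 - (c2_sq g A2 s2)%:C) - k%:C by rewrite /p0 /p1 !hornerE.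
  rewrite zp pE => near_z; exists z; split.
    by apply/eigenvalue_two_layer => //; apply/eqP; rewrite -subr_eq0 -pE.
  move: near_z; rewrite distrC -lecR -normc_real /q -/k.
  by rewrite !(rmorphXn, rmorphM, rmorphB).
have [lam lamP] := choice near_root.
exists lam; split; first by apply: filterE => t; have [] := lamP t.
apply/cvg_complexP => e e0.
have qF : q^~ (u1 + s) @ F --> (0 : R).
  (* In the limit the value is [(s ^+ 2 - a) * (s ^+ 2 - b) - a * b], zero as [s ^+ 2 = a + b].
     Squares are written as products to match [cvgM]. *)
  have q0 : ((u1 + s - u1) * (u1 + s - u1) - c1_sq g A1 s1 s2 1) *
      ((u1 + s - u1) * (u1 + s - u1) - c2_sq g A2 s2) -
      1 * g * (A1 / s2) * c2_sq g A2 s2 = 0.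
    have -> : u1 + s - u1 = s by ring.
    rewrite -expr2 sE /c1_sq /c2_sq subrr mul0r addr0; field.
    by rewrite gt_eqF.
  have lim_c1 : c1_sq g A1 s1 s2 (r t) @[t --> F] --> c1_sq g A1 s1 s2 1.
    exact: cvgM (cvg_cst _) (cvgD (cvgM rF (cvg_cst _))
      (cvgM (cvgB (cvg_cst _) rF) (cvg_cst _))).
  have lim_x : u1 + s - u2 t @[t --> F] --> u1 + s - u1 by exact: cvgB (cvg_cst _) u2F.
  rewrite -q0.
  exact: cvgB (cvgM (cvgB (cvg_cst _) lim_c1) (cvgB (cvgM lim_x lim_x) (cvg_cst _)))
    (cvgM (cvgM (cvgM rF (cvg_cst _)) (cvg_cst _)) (cvg_cst _)).
have e4 : 0 < e ^+ 4 by rewrite exprn_gt0.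
have /cvgr0Pnorm_lt/(_ _ e4) q_small := qF.
near=> t; have [_ le4] := lamP t.
rewrite -(@ltr_pXn2r _ 4) ?nnegrE ?(ltW e0) //.
  by apply: le_lt_trans le4 _; near: t.
exact: normc_ge0.
Unshelve. all: by end_near.
Qed.

(** * Expansion of the external eigenvalues *)

(** Both signs are treated at once: [s] is [c] or [- c], while [c] remains the positive scale of
    [delta]. The estimate is [root_perturbation] at [d = c * delta] and [e = eps]. *)
Lemma external_expansion (R : realType) (g u1 A1 A2 s1 s2 c s : R)
    (T : Type) (F : filter_on T) (u2 r : T -> R) (lam : T -> R[i]^o)
    (delta := fun t => (u2 t - u1) / c) (eps := fun t => 1 - r t) :
  0 < g -> 0 < A1 -> 0 < A2 -> 0 < s1 -> 0 < s2 -> 0 < c ->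
  s ^+ 2 = g * (A1 + A2) / s2 ->
  delta @ F --> (0 : R) -> eps =O_F delta ->
  eigenvalue_tending_to F
    (fun t => two_layer_mx g u1 (u2 t) A1 A2 s1 s2 (r t)) (u1 + s) lam ->
  exists2 h : T -> R[i]^o, h =O_F (fun t => ((delta t ^+ 2)%:C : R[i]^o)) &
    forall t, lam t = (ubar u1 (u2 t) A1 A2 + s - eps t / 2 * (g * A1 / s2 / s) *
      (1 - g * A1 / s1 / s ^+ 2))%:C + c%:C * h t.
Proof.
move=> g0 A10 A20 s10 s20 c0 sE delta0 /eqO_exP[k k0 eps_delta] [eig_lam lam_cvg].
have c_neq0 : c%:C != 0 by apply/eqP => /complexI /eqP; rewrite gt_eqF.
pose E t := ubar u1 (u2 t) A1 A2 + s - eps t / 2 * (g * A1 / s2 / s) *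
  (1 - g * A1 / s1 / s ^+ 2).
exists (fun t => (lam t - (E t)%:C) / c%:C); last first.
  by move=> t; rewrite -/(E t) [X in _ = _ + X]mulrC divfK // addrC subrK.
have A0 : 0 < A1 + A2 by rewrite addr_gt0.
have s0 : s != 0.
  by rewrite -sqrf_eq0 sE gt_eqF // !(mulr_gt0, invr_gt0).
have ds t : u2 t - u1 = c * delta t by rewrite /delta mulrC divfK // gt_eqF.
pose a := g * A1 / s2; pose b := g * A2 / s2; pose m := a - g * A1 / s1.
have sab : s ^+ 2 = a + b by rewrite sE /a /b; field; rewrite gt_eqF.
have kc0 : 0 <= k / c by rewrite divr_ge0 ?ltW.
have [eta [K [eta0 K0 bound]]] := root_perturbation m kc0 s0 sab.
have eta_c : 0 < eta / c by rewrite divr_gt0.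
have /cvgr0Pnorm_lt/(_ _ eta_c) delta_small := delta0.
have lam_small := (cvg_complexP _ _ _).1 lam_cvg _ eta0.
(* Dividing [K * (c * delta) ^+ 2] by [c] leaves [K * c * delta ^+ 2]; the added 1 makes the
   constant strictly positive. *)
apply/eqO_exP; exists (K * c + 1)%:C.
  by rewrite ltcR ltr_pwDr // mulr_ge0 // ltW.
near=> t.
have dt : `|u2 t - u1| < eta.
  rewrite ds normrM gtr0_norm // mulrC -ltr_pdivlMr //.
  by near: t.
have lt : normc (lam t - (u1 + s)%:C) < eta by near: t.
have et : `|eps t| <= k / c * `|u2 t - u1|.
  rewrite ds normrM gtr0_norm // mulrA divfK ?gt_eqF //; by near: t.
have eig : eigenvalue (map_mx (real_complex R)
    (two_layer_mx g u1 (u2 t) A1 A2 s1 s2 (r t))) (lam t) by near: t.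
have c20 : c2_sq g A2 s2 != 0 by rewrite gt_eqF // !(mulr_gt0, invr_gt0).
have := bound _ _ _ (ltW lt) (ltW dt) et.
have -> : s%:C + (lam t - (u1 + s)%:C) = lam t - u1%:C by rewrite rmorphD /=; ring.
have -> : lam t - u1%:C - (u2 t - u1)%:C = lam t - (u2 t)%:C by rewrite rmorphB /=; ring.
have -> : a - eps t * m = c1_sq g A1 s1 s2 (r t).
  by rewrite /a /m /a /eps /c1_sq; ring.
have -> : (1 - eps t) * a * b = r t * g * (A1 / s2) * c2_sq g A2 s2.
  by rewrite /eps /a /b /c2_sq; ring.
move=> /(_ ((eigenvalue_two_layer _ _ _ _ _ _ c20).1 eig)).
(* The drift term of L turns [u1] into [ubar], because [b / s ^+ 2] is the area fraction of the
   second layer. *)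
have -> : lam t - (u1 + s)%:C - (b / s ^+ 2 * (u2 t - u1) -
    eps t * (a * (m + b) / (2 * s ^+ 3)))%:C = lam t - (E t)%:C.
  rewrite -addrA -opprD -rmorphD; congr (_ - _%:C).
  rewrite /E /ubar.
  have -> : m + b = s ^+ 2 - g * A1 / s1 by rewrite sab /m; ring.
  have -> : b / s ^+ 2 = A2 / (A1 + A2).
    by rewrite sE /b; field; rewrite !gt_eqF.
  by rewrite /a; field; rewrite ?s0 !gt_eqF.
move=> le_K.
have cC : `|c%:C| = c%:C :> R[i] by rewrite gtr0_norm // ltcR.
rewrite [leLHS]normrM normfV cC ler_pdivrMr ?ltcR //.
have -> : `|((delta t ^+ 2)%:C : R[i]^o)| = (delta t ^+ 2)%:C :> R[i].
  by rewrite [LHS]ger0_norm // lecR sqr_ge0.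
rewrite -!rmorphM lecR; apply: le_trans le_K _.
by rewrite ds exprMn; have := sqr_ge0 (delta t); nra.
Unshelve. all: by end_near.
Qed.

(* [u2] and [r] vary along an arbitrary filter [F] on an arbitrary parameter
   type; the remaining data are fixed.  The first two conjuncts say that
   external eigenvalues exist, so that the expansions are not vacuous. *)
Theorem proposition3 (R : realType) (g u1 A1 A2 s1 s2 : R)
  (g_gt0 : 0 < g) (A1_gt0 : 0 < A1) (A2_gt0 : 0 < A2)
  (s1_gt0 : 0 < s1) (s2_gt0 : 0 < s2)
  (T : Type) (F : filter_on T) (u2 r : T -> R) :
  let c := cbar g A1 A2 s2 in
  let u : T -> R := fun t => ubar u1 (u2 t) A1 A2 in
  let delta : T -> R := fun t => (u2 t - u1) / c in
  let eps : T -> R := fun t => 1 - r t in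
  let M := fun t => two_layer_mx g u1 (u2 t) A1 A2 s1 s2 (r t) in
  let ext_p := eigenvalue_tending_to F M (u1 + c) in
  let ext_m := eigenvalue_tending_to F M (u1 - c) in
  (\forall t \near F, r t <= 1) ->
  delta @ F --> (0 : R) -> eps @ F --> (0 : R) ->
  eps =O_F delta -> delta =O_F eps ->
  [/\ exists lam, ext_p lam,
      exists lam, ext_m lam,
      forall lam, ext_p lam ->
        exists2 h : T -> R[i]^o, h =O_F (fun t => ((delta t ^+ 2)%:C : R[i]^o)) &
          forall t, lam t =
            (u t + c - eps t / 2 *
              ((g * A1 / s2) / Num.sqrt (g * (A1 + A2) / s2)) *
              (1 - (g * A1 / s1) / (g * (A1 + A2) / s2)))%:C + c%:C * h t
    & forall lam, ext_m lam ->
        exists2 h : T -> R[i]^o, h =O_F (fun t => ((delta t ^+ 2)%:C : R[i]^o)) &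
          forall t, lam t =
            (u t - c + eps t / 2 *
              ((g * A1 / s2) / Num.sqrt (g * (A1 + A2) / s2)) *
              (1 - (g * A1 / s1) / (g * (A1 + A2) / s2)))%:C + c%:C * h t].
Proof.
move=> c u delta eps M ext_p ext_m _ delta0 eps0 eps_delta _.
have c0 : 0 < c by rewrite sqrtr_gt0 !(mulr_gt0, invr_gt0, addr_gt0).
have cE : c ^+ 2 = g * (A1 + A2) / s2.
  by rewrite sqr_sqrtr // ltW // !(mulr_gt0, invr_gt0, addr_gt0).
have NcE : (- c) ^+ 2 = g * (A1 + A2) / s2 by rewrite sqrrN.
have u2_u1 : u2 @ F --> u1.
  have -> : u2 = fun t => u1 + c * delta t.
    by apply/funext => t; rewrite mulrC divfK ?gt_eqF // addrC subrK.
  by rewrite -[X in _ --> X]addr0 -(mulr0 c);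
    apply: cvgD (cvg_cst _) (cvgM (cvg_cst _) delta0).
have r_1 : r @ F --> (1 : R).
  have -> : r = fun t => 1 - eps t by apply/funext => t; rewrite /eps subKr.
  by rewrite -[X in _ --> X]subr0; apply: cvgB (cvg_cst _) eps0.
split.
- exact: ex_eigenvalue_tending_to.
- exact: ex_eigenvalue_tending_to.
- move=> lam lamP.
  have [h hO hE] := external_expansion g_gt0 A1_gt0 A2_gt0 s1_gt0 s2_gt0 c0 cE
    delta0 eps_delta lamP.
  by exists h => // t; rewrite hE cE.
- move=> lam lamP.
  have [h hO hE] := external_expansion g_gt0 A1_gt0 A2_gt0 s1_gt0 s2_gt0 c0 NcE
    delta0 eps_delta lamP.
  (* Division by [s = - c] reverses the sign of the [eps] term. *)
  by exists h => // t; rewrite hE NcE invrN !mulrN !mulNr opprK.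
Qed.
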